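(* Let $S\subset\mathbb{R}^d$ be nonempty and closed. Suppose that $C\subset C^n\subset\mathbb{R}^d$ ($n\in\mathbb{N}$) are closed, $F^0\subset\mathrm{usc\text{-}fcns}(S)$ is closed and equi-usc at every $x\in S$, and there is a (measurable) function $g:S\to[0,\infty]$ with $\int\|x\|g(x)\,dx<\infty$ and $|f(x)|\leq g(x)$ for all $x\in S$ and $f\in F^0$. Let $$F=\Big\{f\in F^0\ \Big|\ \int xf(x)\,dx\in C\Big\}\quad\text{and}\quad F^n=\Big\{f\in F^0\ \Big|\ \int xf(x)\,dx\in C^n\Big\}.$$ If $C^n$ set-converges to $C$, then $F^n$ set-converges to $F$.
   Context: $\mathrm{usc\text{-}fcns}(S)$ is the set of upper semicontinuous functions $f:S\to[-\infty,\infty]$ with $f\not\equiv-\infty$, equipped with the Attouch-Wets distance $\mathbf{d}$: with $\operatorname{hypo} f=\{(x,\alpha)\in S\times\mathbb{R}\mid f(x)\geq\alpha\}$, any fixed norm on $\mathbb{R}^d\times\mathbb{R}$ and any fixed $z^{\rm ctr}\in S\times\mathbb{R}$, $\mathbf{d}(f,g)=\int_0^\infty\max_{\|z-z^{\rm ctr}\|\leq\rho}|\operatorname{dist}(z,\operatorname{hypo} f)-\operatorname{dist}(z,\operatorname{hypo} g)|e^{-\rho}d\rho$. Convergence $\mathbf{d}(f^n,f)\to0$ is equivalent to hypo-convergence: $\limsup f^n(x^n)\leq f(x)$ for all $x\in S$ and all $x^n\in S\to x$, and for every $x\in S$ there is $x^n\in S\to x$ with $\liminf f^n(x^n)\geq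 f(x)$. Closedness and set-convergence of classes of functions are with respect to $\mathbf{d}$. Set-convergence: $\operatorname{OutLim}A^n$ is the collection of points to which a subsequence of some sequence $\{a^n\in A^n\}$ converges; $\operatorname{InnLim}A^n$ is the collection of points to which some sequence $\{a^n\in A^n\}$ converges; $A^n$ set-converges to $A$ if both equal $A$. Equi-usc: let $\mathbb{B}(\bar x,\delta)=\{x\in S\mid\|\bar x-x\|\leq\delta\}$. A sequence $\{f^n\}\subset\mathrm{usc\text{-}fcns}(S)$ is equi-usc at $\bar x\in S$ when $f^n(\bar x)\to\infty$, or when for every $\rho,\epsilon\in(0,\infty)$ there exist $\bar n\in\mathbb{N}$ and $\delta>0$ such that $\sup_{x\in\mathbb{B}(\bar x,\delta)}f^n(x)\leq\max\{f^n(\bar x)+\epsilon,-\rho\}$ for all $n\geq\bar n$. A class $F^0$ is equi-usc at $\bar x$ when every sequence $\{f^n\in F^0,n\in\mathbb{N}\}$ is equi-usc at $\bar x$. Integrals are over $S$ with respect to Lebesgue measure. *)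

(* Defs.v *)
From HB Require Import structures.
From mathcomp Require Import all_boot all_order all_algebra.
From mathcomp Require Import all_classical all_reals all_analysis.
From mathcomp Require Import measurable_realfun.

Set Implicit Arguments.
Unset Strict Implicit.
Unset Printing Implicit Defensive.

Import Order.TTheory GRing.Theory Num.Theory.
Import numFieldNormedType.Exports.

Local Open Scope classical_set_scope.
Local Open Scope ring_scope.

(** * Lebesgue measure on R^(d+1) *)

Section lebesgue.
Context {R : realType} {d : nat}.
Local Open Scope ereal_scope.

Definition box (c : 'rV[R]_d.+1 * 'rV[R]_d.+1) : set 'rV[R]_d.+1 :=
  [set x | forall i, (c.1 ord0 i <= x ord0 i < c.2 ord0 i)%R].

Definition box_volume (c : 'rV[R]_d.+1 * 'rV[R]_d.+1) : R :=
  (\prod_(i < d.+1) Num.max 0 (c.2 ord0 i - c.1 ord0 i))%R.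

Definition box_cover (A : set 'rV[R]_d.+1) :
    set (nat -> 'rV[R]_d.+1 * 'rV[R]_d.+1) :=
  [set c | A `<=` \bigcup_k box (c k)].

Definition lebesgue_outer (A : set 'rV[R]_d.+1) : \bar R :=
  ereal_inf [set \sum_(k <oo) (box_volume (c k))%:E | c in box_cover A].

Lemma box_volume_ge0 c : 0 <= (box_volume c)%:E.
Proof. by rewrite lee_fin; apply: prodr_ge0 => i _; rewrite le_max lexx. Qed.

Lemma lebesgue_outer_ge0 A : 0 <= lebesgue_outer A.
Proof.
apply: le_ereal_inf_tmp => _ [c _ <-].
by apply: nneseries_ge0 => n _ _; exact: box_volume_ge0.
Qed.

Lemma lebesgue_outer0 : lebesgue_outer set0 = 0.
Proof.
apply/eqP; rewrite eq_le lebesgue_outer_ge0 andbT.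
apply: ereal_inf_lbound; exists (fun=> (0%R, 0%R)); first by move=> x.
apply: eseries0 => k _ _ /=.
by rewrite /box_volume big_ord_recl /= !mxE subrr maxxx mul0r.
Qed.

Lemma le_lebesgue_outer :
  {homo lebesgue_outer : A B / A `<=` B >-> A <= B}.
Proof.
move=> A B AB; apply/ereal_inf_le_tmp => x [c Bc <-].
by exists c => //; exact: subset_trans AB Bc.
Qed.

Lemma lebesgue_outer_sigma_subadditive : sigma_subadditive lebesgue_outer.
Proof.
move=> A; have [[i ioo]|] := pselect (exists i, lebesgue_outer (A i) = +oo).
  rewrite (eseries_pinfty _ _ ioo) ?leey// => n _.
  by rewrite -ltNye (lt_le_trans _ (lebesgue_outer_ge0 _)).
rewrite -forallNE => Aoo.
suff add2e (e : {posnum R}) : lebesgue_outer (\bigcup_n A n) <=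
    \sum_(i <oo) lebesgue_outer (A i) + e%:num%:E.
  by apply/lee_addgt0Pr => _/posnumP[].
rewrite (le_trans _ (epsilon_trick _ _ _))//; last first.
  by move=> n; exact: lebesgue_outer_ge0.
pose P n c := box_cover (A n) c /\
  \sum_(k <oo) (box_volume (c k))%:E <=
    lebesgue_outer (A n) + (e%:num / (2 ^ n.+1)%:R)%:E.
have [G PG] : {G & forall n, P n (G n)}.
  apply: (@choice _ _ P) => n.
  have fA : lebesgue_outer (A n) \is a fin_num.
    rewrite ge0_fin_numE ?lebesgue_outer_ge0// ltey; exact/eqP/Aoo.
  have en1 : (0 < e%:num / (2 ^ n.+1)%:R)%R by [].
  have [_ [c Ac <-] cA] := lb_ereal_inf_adherent en1 fA.
  by exists c; split => //; exact/ltW.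
pose v (p : nat * nat) := (box_volume (G p.1 p.2))%:E.
have v_ge0 p : 0 <= v p by exact: box_volume_ge0.
apply: (@le_trans _ _ (\esum_(p in setT) v p)).
  apply: ereal_inf_lbound => /=.
  have /card_esym/ppcard_eqP[f] := card_nat2.
  exists (fun k => G (f k).1 (f k).2).
    move=> x [n _ /(PG n).1[k _ Gx]]; exists (f^-1%FUN (n, k)) => //=.
    by rewrite invK ?inE.
  transitivity (\sum_(k <oo) v (f k)); first by [].
  rewrite -(esum_pred_image v _ xpredT) ?[fun=> _]set_true//.
  by rewrite image_eq.
rewrite (_ : esum _ _ = \sum_(i <oo) \sum_(j <oo) v (i, j)); last first.
  pose J : nat -> set (nat * nat) := fun i => [set (i, j) | j in setT].
  rewrite (_ : setT = \bigcup_k J k); last first.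
    by rewrite predeqE => -[a b]; split => // _; exists a => //; exists b.
  rewrite esum_bigcupT //=; last first.
    apply/trivIsetP => i j _ _ ij.
    rewrite predeqE => -[n m] /=; split => //= -[] [_] _ [<-{n} _].
    by move=> [m' _] [] /esym/eqP; rewrite (negbTE ij).
  rewrite -(image_id [set: nat]) -fun_true esum_pred_image//; last first.
    by move=> n _; exact: esum_ge0.
  apply: eq_eseriesr => /= j _.
  rewrite -(esum_pred_image v (pair j) predT)//=; last first.
    by move=> ? ? _ _; exact: (@can_inj _ _ _ snd).
  by congr esum; rewrite predeqE => -[a b]; split; move=> [i _ <-]; exists i.
apply: lee_lim.
- by apply: is_cvg_nneseries => n *; apply: nneseries_ge0 => m *; exact: v_ge0.
- apply: is_cvg_nneseries => n *; apply: adde_ge0 => //.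
  exact: lebesgue_outer_ge0.
- by near=> n; apply: lee_sum => i _; exact: (PG i).2.
Unshelve. all: by end_near. Qed.

HB.instance Definition _ := isOuterMeasure.Build R 'rV[R]_d.+1 lebesgue_outer
  lebesgue_outer0 lebesgue_outer_ge0 le_lebesgue_outer
  lebesgue_outer_sigma_subadditive.

End lebesgue.

(** R^(d+1) with the sigma-algebra of Lebesgue-measurable (i.e.,
    Caratheodory-measurable for [lebesgue_outer]) sets *)
Definition rVleb (R : realType) (d : nat) :
    measurableType (caratheodory_display (@lebesgue_outer R d)) :=
  caratheodory_type (@lebesgue_outer R d).

Definition rV_lebesgue (R : realType) (d : nat) : set (rVleb R d) -> \bar R :=
  lebesgue_outer.

HB.instance Definition _ (R : realType) (d : nat) :=
  isMeasure.Build _ (rVleb R d) R (@rV_lebesgue R d)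
    (@caratheodory_measure0 _ _ (@lebesgue_outer R d))
    (@caratheodory_measure_ge0 _ _ (@lebesgue_outer R d))
    (@caratheodory_measure_sigma_additive _ _ (@lebesgue_outer R d)).

Definition is_norm (R : realType) (V : lmodType R) (N : V -> R) : Prop :=
  [/\ forall x y, N (x + y) <= N x + N y,
      forall (a : R) x, N (a *: x) = `|a| * N x
    & forall x, N x = 0 -> x = 0].

(** * Painleve-Kuratowski limits, for a given notion of convergence *)

Section set_convergence.
Context {T : Type} (cvg_to : (nat -> T) -> T -> Prop).

Definition OutLim (A : nat -> set T) : set T :=
  [set x | exists2 phi : nat -> nat, {homo phi : m n / (m < n)%N} &
           exists2 a : nat -> T, forall k, A (phi k) (a k) & cvg_to a x].

(** Membership is only required eventually, so that finitely many empty sets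
    do not matter (as they do not for [OutLim]). *)
Definition InnLim (A : nat -> set T) : set T :=
  [set x | exists2 a : nat -> T, \forall n \near \oo, A n (a n) & cvg_to a x].

Definition set_cvg (A : nat -> set T) (B : set T) : Prop :=
  OutLim A = B /\ InnLim A = B.

End set_convergence.

Definition rV_cvg (R : realType) (d : nat)
    (a : nat -> 'rV[R]_d.+1) (x : 'rV[R]_d.+1) : Prop :=
  a n @[n --> \oo] --> x.

(** * Upper semicontinuous functions S -> [-oo, +oo]

    A function on S is represented by an arbitrary extension to R^(d+1); the
    notions below only depend on its values on S. Two extensions of the same
    function are at distance 0, hence both or neither belong to a given closed
    class. *)

Section usc_functions.
Context {R : realType} {d : nat} (S : set 'rV[R]_d.+1).
Implicit Types f g : 'rV[R]_d.+1 -> \bar R.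
Local Open Scope ereal_scope.

Definition usc_fcns : set ('rV[R]_d.+1 -> \bar R) :=
  [set f | (forall x, S x -> forall a : R, f x < a%:E ->
              \forall y \near x, S y -> f y < a%:E) /\
           (exists2 x, S x & f x != -oo)].

(** R^o rather than R makes the product a module over R. *)
Definition hypo f : set ('rV[R]_d.+1 * R^o) :=
  [set z | S z.1 /\ z.2%:E <= f z.1].

Section attouch_wets.
Variables (N : 'rV[R]_d.+1 * R^o -> R) (zctr : 'rV[R]_d.+1 * R^o).

Definition dist (z : 'rV[R]_d.+1 * R^o) (A : set ('rV[R]_d.+1 * R^o)) : R :=
  inf [set N (z - y)%R | y in A].

Definition aw_dist f g : \bar R :=
  \int[lebesgue_measure]_(rho in `[0%R, +oo[)
    (ereal_sup [set `|dist z (hypo f) - dist z (hypo g)|%:E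
               | z in [set z | (N (z - zctr) <= rho)%R]]
     * (expR (- rho))%:E).

Definition aw_cvg (fn : nat -> 'rV[R]_d.+1 -> \bar R) f : Prop :=
  usc_fcns f /\ aw_dist (fn n) f @[n --> \oo] --> 0.

Definition aw_closed (F : set ('rV[R]_d.+1 -> \bar R)) : Prop :=
  forall fn f, (forall n, F (fn n)) -> aw_cvg fn f -> F f.

End attouch_wets.

Section equi_usc.
Variable nrm : 'rV[R]_d.+1 -> R.

Definition cball (xbar : 'rV[R]_d.+1) (delta : R) : set 'rV[R]_d.+1 :=
  [set x | S x /\ (nrm (xbar - x) <= delta)%R].

Definition equi_usc_seq (fn : nat -> 'rV[R]_d.+1 -> \bar R)
    (xbar : 'rV[R]_d.+1) : Prop :=
  fn n xbar @[n --> \oo] --> +oo \/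
  forall rho eps : R, (0 < rho)%R -> (0 < eps)%R ->
    exists nbar : nat, exists2 delta : R, (0 < delta)%R &
      forall n, (nbar <= n)%N ->
        ereal_sup [set fn n x | x in cball xbar delta] <=
          maxe (fn n xbar + eps%:E) (- rho)%:E.

Definition equi_usc (F : set ('rV[R]_d.+1 -> \bar R))
    (xbar : 'rV[R]_d.+1) : Prop :=
  forall fn, (forall n, F (fn n)) -> equi_usc_seq fn xbar.

End equi_usc.

(** The vector integral of x f(x) over S. [fine] is harmless whenever
    [|x| * |f x|] is integrable on S. *)
Definition mean f : 'rV[R]_d.+1 :=
  \row_(i < d.+1)
    fine (\int[@rV_lebesgue R d]_(x in S) (((x : 'rV[R]_d.+1) ord0 i)%:E * f x)).

End usc_functions.

(* Main.v *)
(* Along a subsequence with f_k in F^(phi k) converging to f, the distances from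
   any fixed point to the hypographs converge, so hypo-convergence holds; together
   with equi-upper-semicontinuity this upgrades to pointwise convergence on S.
   Since norms are equivalent, |x_i| g(x) is integrable, and dominated convergence
   gives convergence of the means, whose limit lies in OutLim C^n = C. The other
   inclusion is witnessed by constant sequences because C is contained in every
   C^n. *)
Require Import Defs.
From HB Require Import structures.
From mathcomp Require Import all_boot all_order all_algebra.
From mathcomp Require Import all_classical all_reals all_analysis.
From mathcomp Require Import measurable_realfun lra.
Set Implicit Arguments.
Unset Strict Implicit.
Unset Printing Implicit Defensive.
Import Order.TTheory GRing.Theory Num.Theory.
Import numFieldNormedType.Exports.
Local Open Scope classical_set_scope.
Local Open Scope ring_scope.

(** * Equivalence of norms with the sup norm *)

Section norm_equivalence.
Context {R : realType}.

Lemma is_norm0 (V : lmodType R) (N : V -> R) : is_norm N -> N 0 = 0.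
Proof. by case=> _ NZ _; rewrite -(scale0r 0) NZ normr0 mul0r. Qed.

Lemma is_normN (V : lmodType R) (N : V -> R) x : is_norm N -> N (- x) = N x.
Proof. by case=> _ NZ _; rewrite -scaleN1r NZ normrN1 mul1r. Qed.

Lemma is_norm_ge0 (V : lmodType R) (N : V -> R) x : is_norm N -> 0 <= N x.
Proof.
move=> NN; have [ND _ _] := NN; have := ND x (- x).
by rewrite subrr is_norm0// is_normN// -mulr2n pmulrn_lge0.
Qed.

Lemma is_norm_sum (V : lmodType R) (N : V -> R) I (s : seq I) (F : I -> V) :
  is_norm N -> N (\sum_(i <- s) F i) <= \sum_(i <- s) N (F i).
Proof.
move=> NN; have [ND _ _] := NN.
apply: (big_ind2 (fun x y => N x <= y)) => //; first by rewrite is_norm0.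
by move=> x1 x2 y1 y2 h1 h2; apply: le_trans (ND _ _) _; exact: lerD.
Qed.

Lemma le_coord_norm n (x : 'rV[R]_n) i : `|x ord0 i| <= `|x|.
Proof.
rewrite [leRHS]/Num.norm /= mx_normrE.
exact: (le_bigmax_cond _ (fun ij => `|x ij.1 ij.2|) (j := (ord0, i))).
Qed.

(** Expand along the standard basis and apply the triangle inequality; the summand 1 in the constant
    makes it positive. *)
Lemma is_norm_rV_le n (N : 'rV[R]_n -> R) : is_norm N ->
  exists2 K, 0 < K & forall x, N x <= K * `|x|.
Proof.
move=> NN; have [_ NZ _] := NN.
exists (1 + \sum_i N (delta_mx 0 i)).
  by rewrite ltr_pwDl// sumr_ge0// => i _; exact: is_norm_ge0.
move=> x; rewrite {1}(row_sum_delta x) (le_trans (is_norm_sum _ _ NN))//.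
rewrite mulrDl mul1r ler_wpDl// mulr_suml ler_sum// => i _.
by rewrite NZ mulrC ler_wpM2l ?is_norm_ge0// le_coord_norm.
Qed.

Lemma is_norm_rV_prod_le n (N : 'rV[R]_n * R^o -> R) : is_norm N ->
  exists2 K, 0 < K & forall z, N z <= K * `|z|.
Proof.
move=> NN; have [ND NZ N0] := NN.
have N1 : is_norm (fun x => N (x, 0)).
  split=> [x y|a x|x /N0 [//]].
    by have := ND (x, 0) (y, 0); rewrite [X in N X](_ : _ = (x + y, 0 + 0))// addr0.
  by rewrite -NZ [X in _ = N X](_ : _ = (a *: x, a *: 0))// scaler0.
have [K K0 NK] := is_norm_rV_le N1; exists (K + N (0, 1)).
  by rewrite ltr_wpDr// is_norm_ge0.
move=> [x a]; have xaE : (x, a) = (x, 0) + a *: (0, 1) :> 'rV[R]_n * R^o.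
  transitivity (x + a *: 0, 0 + a *: (1 : R^o)) => //.
  by rewrite scaler0 addr0 add0r [a *: _]mulr1.
rewrite {1}xaE (le_trans (ND _ _))// NZ mulrDl lerD//.
  by rewrite (le_trans (NK _))// ler_pM2l// prod_normE le_max lexx.
by rewrite mulrC ler_wpM2l ?is_norm_ge0// prod_normE le_max lexx orbT.
Qed.

Lemma is_norm_continuous (V : normedModType R) (N : V -> R) (K : R) :
  is_norm N -> 0 < K -> (forall x, N x <= K * `|x|) -> continuous N.
Proof.
move=> NN K0 NK; have [ND _ _] := NN.
move=> x; apply/cvgrPdist_le => e e0; near=> y.
have h u v : N u - N v <= N (u - v).
  by rewrite lerBlDr (le_trans _ (ND _ _))// subrK.
have : `|N x - N y| <= N (x - y).
  by rewrite ler_norml h andbT lerNl opprB -(is_normN (x - y) NN) opprB h.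
move=> /le_trans; apply; rewrite (le_trans (NK _))// -ler_pdivlMl//.
near: y; apply: cvgr_dist_le; first exact: cvg_id.
by rewrite mulr_gt0 ?invr_gt0.
Unshelve. all: by end_near. Qed.

(** The constant is the minimum of [N] on the compact unit sphere, positive because [N] vanishes
    only at 0; homogeneity does the rest. *)
Lemma is_norm_ge (V : normedModType R) (N : V -> R) (K : R) : is_norm N ->
  0 < K -> (forall x, N x <= K * `|x|) -> compact [set x : V | `|x| = 1] ->
  exists2 c, 0 < c & forall x, c * `|x| <= N x.
Proof.
move=> NN K0 NK cS; have [ND NZ N0] := NN.
have scaled (x : V) : x != 0 -> `|(`|x|^-1 *: x)| = 1.
  by move=> x0; rewrite normrZ normfV normr_id mulVf// normr_eq0.
have [S0|S0] := pselect ([set x : V | `|x| = 1] !=set0); last first.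
  (* If the unit sphere is empty, every vector is 0 and any positive constant works. *)
  exists 1 => // x; have [->|x0] := eqVneq x 0.
    by rewrite normr0 mulr0 is_norm_ge0.
  by exfalso; apply: S0; exists (`|x|^-1 *: x); exact: scaled.
have [c /set_mem/= cS1 cmin] := compact_EVT_min S0 cS
  (continuous_subspaceT (is_norm_continuous NN K0 NK)).
exists (N c).
  rewrite lt_neqAle is_norm_ge0// andbT eq_sym; apply/eqP => /N0 c0.
  by move: cS1; rewrite c0 normr0 => /esym/eqP; rewrite oner_eq0.
move=> x; have [->|x0] := eqVneq x 0; first by rewrite normr0 mulr0 is_norm_ge0.
have := cmin (`|x|^-1 *: x); rewrite NZ normfV normr_id mulrC => /(_ _)/[!inE].
by move=> /(_ (scaled _ x0)); rewrite ler_pdivlMr ?normr_gt0.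
Qed.

Lemma closed_norm_preimage (V : normedModType R) (A : set R) :
  closed A -> closed [set x : V | A `|x|].
Proof.
move=> cA; apply: (@preimage_closed _ _ (fun x : V => `|x|) A) => //.
by move=> x _; exact: norm_continuous.
Qed.

Lemma is_norm_rV_ge n (N : 'rV[R]_n -> R) : is_norm N ->
  exists2 c, 0 < c & forall x, c * `|x| <= N x.
Proof.
move=> NN; have [K K0 NK] := is_norm_rV_le NN.
apply: (is_norm_ge NN K0 NK); apply: bounded_closed_compact.
  by exists 1; split=> // M M1 x /= ->; exact: ltW.
exact: (closed_norm_preimage (@closed_eq _ 1)).
Qed.

Lemma is_norm_rV_prod_ge n (N : 'rV[R]_n * R^o -> R) : is_norm N ->
  exists2 c, 0 < c & forall z, c * `|z| <= N z.
Proof.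
move=> NN; have [K K0 NK] := is_norm_rV_prod_le NN.
apply: (is_norm_ge NN K0 NK).
have cB : compact [set x : 'rV[R]_n | `|x| <= 1].
  apply: bounded_closed_compact.
    by exists 1; split=> // M M1 x /= x1; exact: le_trans (ltW M1).
  exact: (closed_norm_preimage (@closed_le _ 1)).
(* The unit sphere of the product is closed in the compact set (closed unit ball) x [-1, 1]. *)
apply: (subclosed_compact _ (compact_setX cB (@segment_compact R (-1) 1))).
  exact: (closed_norm_preimage (@closed_eq _ 1)).
move=> [x a] /=; rewrite prod_normE/= => xa1; split => /=.
  by rewrite -xa1 le_max lexx.
by rewrite in_itv/= -ler_norml -xa1 le_max lexx orbT.
Qed.
End norm_equivalence.

(** * Lebesgue measurability of open and closed sets and of usc functions *)

Section borel.
Context {R : realType} {d : nat}.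
(** Additivity of length when [l, u[ is cut at a, including empty intervals. *)
Lemma max0_split (a l u : R) : Num.max 0 (u - l) =
  Num.max 0 (Num.min a u - l) + Num.max 0 (u - Num.max a l).
Proof.
rewrite /Num.max /Num.min; case: (ltP a u); case: (ltP a l).
all: by repeat (let h := fresh in case: ifPn => h; rewrite -?leNgt in h); lra.
Qed.

Local Open Scope ereal_scope.

(** Half-spaces generate the rest: they and their complements cut out boxes, and boxes make up open
    sets. *)
Lemma caratheodory_halfspace (i : 'I_d.+1) (a : R) :
  measurable ([set x | (x ord0 i < a)%R] : set (rVleb R d)).
Proof.
apply: le_caratheodory_measurable => X /=.
apply: le_ereal_inf_tmp => _ [c Xc <-].
(* Cut each box of a cover along the hyperplane x_i = a. *)
pose lo k : 'rV[R]_d.+1 * 'rV[R]_d.+1 := ((c k).1,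
  \row_j if j == i then Num.min a ((c k).2 ord0 j) else (c k).2 ord0 j)%R.
pose hi k : 'rV[R]_d.+1 * 'rV[R]_d.+1 := (
  \row_j if j == i then Num.max a ((c k).1 ord0 j) else (c k).1 ord0 j, (c k).2)%R.
(* The cut changes only the i-th factor of the product, so [max0_split] gives additivity of
   volume. *)
have volE k : (box_volume (c k))%:E = (box_volume (lo k))%:E + (box_volume (hi k))%:E.
  have vE b : box_volume b = (Num.max 0 (b.2 ord0 i - b.1 ord0 i) *
      \prod_(j | j != i) Num.max 0 (b.2 ord0 j - b.1 ord0 j))%R.
    by rewrite /box_volume (bigD1 i).
  rewrite -EFinD; congr EFin; rewrite !vE /= !mxE eqxx (max0_split a) mulrDl.
  by congr (_ * _ + _ * _)%R; apply: eq_bigr => j /negbTE ji; rewrite !mxE ji.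
under eq_eseriesr do rewrite volE.
rewrite nneseriesD; [|by move=> k _ _; exact: box_volume_ge0..].
apply: leeD; apply: ereal_inf_lbound.
- exists lo => // x [/Xc[k _ ck] xa]; exists k => // j; rewrite /lo/= mxE.
  case: eqP => [->|_]; last exact: ck.
  by have /andP[h1 h2] := ck i; rewrite lt_min xa h1 h2.
- exists hi => // x [/Xc[k _ ck] xa]; exists k => // j; rewrite /hi/= mxE.
  case: eqP => [->|_]; last exact: ck.
  by have /andP[h1 h2] := ck i; rewrite ge_max h1 h2 !andbT leNgt; apply/negP.
Qed.

Lemma measurable_box c : measurable (box c : set (rVleb R d)).
Proof.
have -> : box c = \bigcap_(i in [set: 'I_d.+1])
    (~` [set x | (x ord0 i < c.1 ord0 i)%R] `&` [set x | (x ord0 i < c.2 ord0 i)%R]).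
  apply/seteqP; split=> x h i.
    by move=> _; have /andP[h1 h2] := h i; split => //=; apply/negP; rewrite -leNgt.
  by have [//|/negP + xi] := h i; rewrite -leNgt => ->.
apply: fin_bigcap_measurable => // i _.
by apply: measurableI; [apply: measurableC|]; exact: caratheodory_halfspace.
Qed.

Lemma measurable_open (U : set 'rV[R]_d.+1) :
  open U -> measurable (U : set (rVleb R d)).
Proof.
move=> oU.
pose Q (pq : 'rV[rat]_d.+1 * 'rV[rat]_d.+1) :=
  box (map_mx (@ratr R) pq.1, map_mx (@ratr R) pq.2).
(* U is the union of the rational boxes it contains; there are countably many. *)
suff -> : U = \bigcup_pq (if `[< Q pq `<=` U >] then Q pq else set0).
  apply: countable_bigcupT_measurable; first exact: countableP.
  by move=> pq; case: ifP => _ //; exact: measurable_box.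
apply/seteqP; split=> x; last first.
  by move=> [pq _]; case: asboolP => // + Qx; exact.
move=> Ux; have /nbhs_ballP[e /= e0 xeU] := open_nbhs_nbhs (conj oU Ux).
(* Rational corners within e of x on either side put the box inside the sup-norm ball of radius
   e. *)
have /choice[p pP] (j : 'I_d.+1) : exists q : rat, (x ord0 j - e < ratr q < x ord0 j)%R.
  have [|q] := @rat_in_itvoo R (x ord0 j - e) (x ord0 j); first lra.
  by rewrite in_itv/=; exists q.
have /choice[q qP] (j : 'I_d.+1) : exists q : rat, (x ord0 j < ratr q < x ord0 j + e)%R.
  have [|q] := @rat_in_itvoo R (x ord0 j) (x ord0 j + e); first lra.
  by rewrite in_itv/=; exists q.
exists (\row_j p j, \row_j q j)%R => //; rewrite ifT.
  by move=> j /=; rewrite !mxE; have := pP j; have := qP j; lra.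
apply/asboolP => y Qy; apply: xeU; split=> // i j; rewrite (ord1 i).
have := Qy j; rewrite /= !mxE; have := pP j; have := qP j => h1 h2 h3.
by rewrite /ball/= ltr_norml; lra.
Qed.

(** Upper semicontinuity makes each superlevel set the part of S outside an open set, and these
    superlevel sets suffice. *)
Lemma measurable_usc (S : set 'rV[R]_d.+1) (f : 'rV[R]_d.+1 -> \bar R) :
  closed S ->
  (forall x, S x -> forall a : R, f x < a%:E ->
     \forall y \near x, S y -> f y < a%:E) ->
  measurable_fun (S : set (rVleb R d)) (f : rVleb R d -> \bar R).
Proof.
move=> cS uf mS.
apply: (measurability _ (ErealGenCInfty.measurableE R)) => // _ [_ [a ->] <-].
suff SE : S `&` f @^-1` `[a%:E, +oo[ = S `\` [set y | S y -> f y < a%:E]°.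
  rewrite SE; apply: measurableD => //; apply: measurable_open.
  exact: open_interior.
apply/seteqP; split=> x [Sx]/=; rewrite in_itv/= andbT => fx; split => //.
  by move=> /interior_subset/(_ Sx); rewrite ltNge fx.
by rewrite leNgt; apply/negP => /(uf _ Sx); exact: fx.
Qed.

Lemma measurable_closed (S : set 'rV[R]_d.+1) :
  closed S -> measurable (S : set (rVleb R d)).
Proof.
by move=> cS; rewrite -(setCK S); apply: measurableC; apply: measurable_open;
  exact: closed_openC.
Qed.
End borel.

(** * From Attouch-Wets convergence and equi-usc to pointwise convergence *)

Section attouch_wets_pointwise.
Context {R : realType}.
Local Open Scope ereal_scope.

(* f need not be measurable, so the integrand of aw_dist is covered as it is. *)
Lemma integral_ge_cst d (T : measurableType d) (mu : {measure set T -> \bar R})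
    (D A : set T) (f : T -> \bar R) (c : R) :
  measurable A -> A `<=` D -> (0 <= c)%R -> (forall x, D x -> 0 <= f x) ->
  (forall x, A x -> c%:E <= f x) -> c%:E * mu A <= \int[mu]_(x in D) f x.
Proof.
move=> mA AD c0 f0 cf; rewrite ge0_integralE//.
apply: ereal_sup_ubound; exists (scale_nnsfun (indic_nnsfun R mA) c0).
  move=> x; rewrite patchE /= /mindic indicE; case: ifPn => [|/negP Dx].
    rewrite inE => Dx; case: (boolP (x \in A)) => [/set_mem Ax|_].
      by rewrite mulr1; exact: cf.
    by rewrite mulr0; exact: f0.
  by rewrite memNset ?mulr0// => /AD Dx'; apply: Dx; rewrite inE.
by rewrite (sintegralrM _ _ (indic_nnsfun R mA)) sintegral_indic.
Qed.

Lemma cvge_between (u : nat -> \bar R) (l : \bar R) :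
  (forall a : R, a%:E < l -> \forall n \near \oo, a%:E < u n) ->
  (forall a : R, l < a%:E -> \forall n \near \oo, u n < a%:E) ->
  u n @[n --> \oo] --> l.
Proof.
case: l => [l| |] lo hi.
- apply/fine_cvgP; split.
    near=> n; rewrite fin_numElt; apply/andP; split.
      rewrite (lt_trans (ltNyr (l - 1)))//; near: n; apply: lo.
      by rewrite lte_fin; lra.
    rewrite (lt_trans _ (ltry (l + 1)))//; near: n; apply: hi.
    by rewrite lte_fin; lra.
  apply/cvgrPdist_lt => e e0; near=> n => /=.
  have : (l - e)%:E < u n by near: n; apply: lo; rewrite lte_fin; lra.
  have : u n < (l + e)%:E by near: n; apply: hi; rewrite lte_fin; lra.
  by case: (u n) => //= r; rewrite !lte_fin ltr_norml; lra.
- by apply/cvgeyPgt => a; exact/lo/ltry.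
- by apply/cvgeNyPlt => a; exact/hi/ltNyr.
Unshelve. all: by end_near. Qed.

Context {d : nat} (S : set 'rV[R]_d.+1).
Variables (N : 'rV[R]_d.+1 * R^o -> R) (zctr : 'rV[R]_d.+1 * R^o).
Hypothesis NN : is_norm N.
Implicit Types (f g : 'rV[R]_d.+1 -> \bar R) (A : set ('rV[R]_d.+1 * R^o)).

(** For rho in [r, r + 1] with r = [N (z - zctr)], the point z competes in the supremum and the
    weight is at least exp(-(r + 1)); this interval has measure 1. *)
Lemma aw_dist_ge f g z :
  (`|dist N z (hypo S f) - dist N z (hypo S g)| *
    expR (- (N (z - zctr) + 1)))%R%:E <= aw_dist S N zctr f g.
Proof.
set r := N (z - zctr)%R.
have r0 : (0 <= r)%R by exact: is_norm_ge0.
rewrite -[leLHS]mule1.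
have -> : 1 = lebesgue_measure (`[r, (r + 1)%R]%classic : set R) :> \bar R.
  by rewrite lebesgue_measure_itv/= lte_fin ltrDl ltr01 -EFinB addrC addKr.
pose h (rho : R) := ereal_sup [set `|dist N z (hypo S f) - dist N z (hypo S g)|%R%:E
  | z in [set z | (N (z - zctr) <= rho)%R]].
have hD rho : (r <= rho)%R ->
    `|dist N z (hypo S f) - dist N z (hypo S g)|%R%:E <= h rho.
  by move=> rrho; apply: ereal_sup_ubound; exists z.
apply: integral_ge_cst => //.
- by move=> x/=; rewrite !in_itv/= => /andP[/(le_trans r0) ->].
- move=> rho /=; rewrite in_itv/= andbT => rho0.
  rewrite mule_ge0 ?lee_fin ?expR_ge0//.
  (* The centre lies in every ball of radius rho >= 0, so the supremum is not over the empty set,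
     where it would be -oo. *)
  apply: (@le_trans _ _ `|dist N zctr (hypo S f) - dist N zctr (hypo S g)|%R%:E).
    by rewrite lee_fin.
  by apply: ereal_sup_ubound; exists zctr => //=; rewrite subrr is_norm0.
- move=> rho /=; rewrite in_itv/= => /andP[rrho rho1].
  rewrite EFinM lee_pmul ?lee_fin ?expR_ge0 ?normr_ge0//; first exact: hD.
  by rewrite ler_expR lerN2.
Qed.

(** By [aw_dist_ge], the gap at z is at most the Attouch-Wets distance divided by a positive weight
    depending on z alone. *)
Lemma cvg_dist_hypo (fn : nat -> 'rV[R]_d.+1 -> \bar R) f z :
  aw_dist S N zctr (fn n) f @[n --> \oo] --> 0 ->
  (dist N z (hypo S (fn n)) @[n --> \oo] --> dist N z (hypo S f))%R.
Proof.
move=> /fine_cvgP[fin cv]; apply/cvgrPdist_lt => e e0.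
pose c := expR (- (N (z - zctr) + 1))%R.
have ec0 : (0 < e * c)%R by rewrite mulr_gt0// expR_gt0.
move/cvgrPdist_lt : cv => /(_ _ ec0) cv.
near=> n; rewrite distrC -(ltr_pM2r (expR_gt0 _ : (0 < c)%R)).
apply: (@le_lt_trans _ _ (fine (aw_dist S N zctr (fn n) f))).
  by rewrite -lee_fin fineK ?aw_dist_ge//; near: n.
apply: (@le_lt_trans _ _ `|0 - fine (aw_dist S N zctr (fn n) f)|)%R.
  by rewrite sub0r normrN ler_norm.
by near: n.
Unshelve. all: by end_near. Qed.

Lemma has_lbound_norm z A : has_lbound [set N (z - y)%R | y in A].
Proof. by exists 0%R => _ [y _ <-]; exact: is_norm_ge0. Qed.

Lemma dist_eq0 z A : A z -> dist N z A = 0%R.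
Proof.
move=> Az; apply/eqP; rewrite eq_le; apply/andP; split.
  apply: (ge_inf (has_lbound_norm z A)).
  by exists z => //; rewrite subrr is_norm0.
by apply: lb_le_inf => [|_ [y _ <-]]; [exists (N (z - z)%R), z|exact: is_norm_ge0].
Qed.

(** Nonemptiness matters: [inf] of the empty set is 0 by convention, a small distance without a
    witness. *)
Lemma dist_lt z A (e : R) : A !=set0 -> (dist N z A < e)%R ->
  exists2 y, A y & (N (z - y) < e)%R.
Proof.
move=> [a Aa] /inf_lt[|_ [y Ay <-] ye]; last by exists y.
by exists (N (z - a)%R), a.
Qed.

Lemma hypo_nonempty f : usc_fcns S f -> hypo S f !=set0.
Proof.
move=> [_ [x Sx]]; case fx: (f x) => [r| |]// _.
- by exists (x, r); split => //=; rewrite fx.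
- by exists (x, 0%R); split => //=; rewrite fx leey.
Qed.

(** Pick b with f(x) < b < a. Near x, f stays below b, so a hypograph point is either far from x
    horizontally or more than a - b below height a. *)
Lemma dist_hypo_gt0 f x (a : R) : usc_fcns S f -> S x -> f x < a%:E ->
  (0 < dist N (x, a : R^o) (hypo S f))%R.
Proof.
move=> uf Sx fxa; have [c c0 cN] := is_norm_rV_prod_ge NN.
have [b /andP[fxb ba]] : exists b : R, (f x < b%:E) && (b < a)%R.
  move: fxa; case: (f x) => [r| |]//; last first.
    by exists (a - 1)%R; rewrite ltNyr; lra.
  by rewrite lte_fin => ra; exists ((r + a) / 2)%R; rewrite lte_fin; lra.
have /nbhs_ballP[e /= e0 xe] := uf.1 _ Sx _ fxb.
pose m := Num.min e (a - b)%R.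
have m0 : (0 < m)%R by rewrite lt_min e0 subr_gt0.
apply: (@lt_le_trans _ _ (c * m)%R); first exact: mulr_gt0.
apply: lb_le_inf.
  by have [y hy] := hypo_nonempty uf; exists (N ((x, a : R^o) - y)%R), y.
move=> _ [[y t] [/= Sy ty] <-]; rewrite (le_trans _ (cN _))// ler_pM2l//.
rewrite prod_normE/= leNgt; apply/negP; rewrite gt_max lt_min => /andP[/andP[xye _] at_].
have fyb : f y < b%:E by apply: (xe y) => //; rewrite -ball_normE.
have : t%:E < b%:E by exact: le_lt_trans fyb.
rewrite lte_fin => tb; move: at_; rewrite lt_min => /andP[_].
by rewrite ltr_norml; lra.
Qed.

(** Distance convergence alone yields the upper bound at x. For the lower bound it only yields high
    values at points near x, and equi-usc carries them to x itself. *)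
Lemma equi_usc_cvg (nrm : 'rV[R]_d.+1 -> R)
    (fn : nat -> 'rV[R]_d.+1 -> \bar R) f x :
  is_norm nrm -> (forall n, usc_fcns S (fn n)) -> usc_fcns S f -> S x ->
  equi_usc_seq S nrm fn x -> aw_dist S N zctr (fn n) f @[n --> \oo] --> 0 ->
  fn n x @[n --> \oo] --> f x.
Proof.
move=> nrmN ufn uf Sx eqfn fnf; apply: cvge_between => a; last first.
  (* Upper bound: (x, a) is at positive distance from [hypo S f], hence eventually outside
     [hypo S (fn n)]. *)
  move=> fxa; have d0 := dist_hypo_gt0 uf Sx fxa.
  have := cvg_dist_hypo (z := (x, a : R^o)) fnf => /cvgrPdist_lt/(_ _ d0).
  apply: filterS => n; apply: contraPT; rewrite -leNgt => afn.
  rewrite [dist _ _ (hypo S (fn n))]dist_eq0// subr0 => /ltr_normlW.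
  by rewrite ltxx.
move=> afx; case: eqfn => [/cvgey_gt|eqfn]; first exact.
have [b /andP[ab bfx]] : exists b : R, (a < b)%R && (b%:E < f x).
  move: afx; case: (f x) => [r| |]//; last first.
    by exists (a + 1)%R; rewrite ltry; lra.
  by rewrite lte_fin => ra; exists ((r + a) / 2)%R; rewrite lte_fin; lra.
(* The slack eps is lost twice, in the height of the nearby point and in equi-usc, and b - 2 eps =
   a. *)
pose eps := ((b - a) / 2)%R.
have eps0 : (0 < eps)%R by rewrite /eps; lra.
(* Then -rho < a, so the alternative -rho in the equi-usc bound cannot be the active one. *)
pose rho := (`|a| + 1)%R.
have rho0 : (0 < rho)%R by rewrite ltr_wpDl.
have [nbar [delta delta0 fnd]] := eqfn _ _ rho0 eps0.
have [K K0 nrmK] := is_norm_rV_le nrmN.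
have [c c0 cN] := is_norm_rV_prod_ge NN.
(* The first term keeps the height error below eps; the second keeps the base point in the
   [nrm]-ball of radius delta. *)
pose e := Num.min (c * eps)%R (c * (delta / K))%R.
have e0 : (0 < e)%R.
  by rewrite lt_min; apply/andP; split; apply: mulr_gt0 => //; exact: divr_gt0.
have bf : hypo S f (x, b : R^o) by split => //=; exact: ltW.
have := cvg_dist_hypo (z := (x, b : R^o)) fnf => /cvgrPdist_lt/(_ _ e0) cv.
near=> n.
have : (`|dist N (x, b : R^o) (hypo S f) - dist N (x, b : R^o) (hypo S (fn n))| < e)%R.
  by near: n.
rewrite (dist_eq0 bf) sub0r normrN => /ltr_normlW/(dist_lt (hypo_nonempty (ufn n))).
move=> [[y t] [/= Sy tfn]] /(le_lt_trans (cN _)).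
rewrite lt_min !(ltr_pM2l c0) prod_normE/= !gt_max.
move=> /andP[/andP[_ bt] /andP[xy _]].
have te : (b - eps < t)%R by move: bt; rewrite ltr_norml; lra.
have : t%:E <= maxe (fn n x + eps%:E) (- rho)%:E.
  apply: le_trans tfn _; apply: le_trans (fnd n _); last by near: n; exists nbar.
  apply: ereal_sup_ubound; exists y => //; split => //.
  by rewrite (le_trans (nrmK _))// -ler_pdivlMl// mulrC ltW.
rewrite le_max => /orP[|]; last first.
  rewrite lee_fin /rho => h; exfalso; have := ler_norm (- a).
  by rewrite normrN /eps in te *; lra.
case: (fn n x) => [r| |]//.
- by rewrite -EFinD lee_fin lte_fin => h; rewrite /eps in te h; lra.
- by rewrite ltry.
Unshelve. all: by end_near. Qed.

End attouch_wets_pointwise.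

(** * Convergence of the means by dominated convergence *)

Section mean_convergence.
Context {R : realType} {d : nat}.
Local Open Scope ereal_scope.

Lemma measurable_continuous (S : set 'rV[R]_d.+1) (h : 'rV[R]_d.+1 -> R) :
  closed S -> continuous h ->
  measurable_fun (S : set (rVleb R d)) (fun x : rVleb R d => (h x)%:E).
Proof.
move=> cS ch; apply: (measurable_usc cS) => x Sx a; rewrite lte_fin => hxa.
near=> y => _; rewrite lte_fin; near: y.
exact: (cvgr_lt (h x) (ch x)).
Unshelve. all: by end_near. Qed.

Lemma cvg_rV_coord (u : nat -> 'rV[R]_d.+1) (l : 'rV[R]_d.+1) :
  (forall i, u n ord0 i @[n --> \oo] --> l ord0 i) -> u n @[n --> \oo] --> l.
Proof.
move=> ul; apply/cvg_ballP => e e0.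
have : \forall n \near \oo, forall i, ball (l ord0 i) e (u n ord0 i).
  by apply: filter_forall => i; exact: (cvg_ball (ul i)).
by apply: filterS => n h; split=> // i j; rewrite (ord1 i); exact: h.
Qed.

Lemma cvg_mean (nrm : 'rV[R]_d.+1 -> R) (S : set 'rV[R]_d.+1)
    (g : rVleb R d -> \bar R) (fn : nat -> 'rV[R]_d.+1 -> \bar R) f :
  is_norm nrm -> closed S -> measurable_fun (S : set (rVleb R d)) g ->
  (forall x, S x -> 0 <= g x) ->
  \int[@rV_lebesgue R d]_(x in S) ((nrm x)%:E * g x) < +oo ->
  (forall n, usc_fcns S (fn n)) -> usc_fcns S f ->
  (forall n x, S x -> `|fn n x| <= g x) ->
  (forall x, S x -> fn n x @[n --> \oo] --> f x) ->
  mean S (fn n) @[n --> \oo] --> mean S f.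
Proof.
move=> nrmN cS mg g0 gint ufn uf fng fnf; apply: cvg_rV_coord => i.
have mS := measurable_closed cS.
have [c c0 cnrm] := is_norm_rV_ge nrmN.
have [K K0 nrmK] := is_norm_rV_le nrmN.
have mx : measurable_fun (S : set (rVleb R d))
    (fun x : rVleb R d => ((x : 'rV[R]_d.+1) ord0 i)%:E).
  exact: (measurable_continuous cS (@coord_continuous _ _ _ ord0 i)).
have mnrm := measurable_continuous cS (is_norm_continuous nrmN K0 nrmK).
have mf h : usc_fcns S h -> measurable_fun (S : set (rVleb R d))
    (fun x : rVleb R d => ((x : 'rV[R]_d.+1) ord0 i)%:E * h x).
  by move=> [uh _]; apply: emeasurable_funM => //; exact: measurable_usc.
(* The majorant for coordinate i; it is integrable because |x_i| is at most [nrm x] / c. *)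
pose G (x : rVleb R d) := `|((x : 'rV[R]_d.+1) ord0 i)%:E| * g x.
have mG : measurable_fun (S : set (rVleb R d)) G.
  by apply: emeasurable_funM => //; apply: measurableT_comp.
have iG : (@rV_lebesgue R d).-integrable S G.
  apply/integrableP; split=> //.
  apply: (@le_lt_trans _ _
    (\int[@rV_lebesgue R d]_(x in S) ((c^-1)%:E * ((nrm x)%:E * g x)))).
    apply: ge0_le_integral => //.
    - exact: measurableT_comp.
    - by apply: measurable_funeM; exact: emeasurable_funM.
    - move=> x Sx; rewrite gee0_abs ?mule_ge0 ?g0// muleA lee_wpmul2r ?g0//.
      rewrite -EFinM lee_fin ler_pdivlMl//.
      by rewrite (le_trans _ (cnrm _))// ler_pM2l// le_coord_norm.
  rewrite ge0_integralZl_EFin// ?invr_ge0 ?(ltW c0)//.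
  - by rewrite lte_mul_pinfty// lee_fin invr_ge0 ltW.
  - by move=> x Sx; rewrite mule_ge0 ?g0// lee_fin is_norm_ge0.
  - exact: emeasurable_funM.
have [||fi _ cv] := dominated_convergence mS
  (fun n => mf _ (ufn n)) (mf _ uf) _ iG.
(* The factor x_i is finite, so multiplying by it preserves limits, infinite ones included. *)
- apply: aeW => x Sx; apply: cvgeZl => //; exact: fnf.
- by apply: aeW => x n Sx; rewrite abseM lee_wpmul2l// fng.
rewrite !mxE; under eq_fun do rewrite mxE.
(* The limit integral is finite, so [fine] passes to the limit. *)
apply: fine_cvg; rewrite fineK//; exact: integrable_fin_num.
Qed.

End mean_convergence.

(** * Set-convergence of the constrained classes *)

Local Open Scope ereal_scope.

Theorem proposition4p9 (R : realType) (d : nat)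
    (nrm : 'rV[R]_d.+1 -> R) (nrm_norm : is_norm nrm)
    (N : 'rV[R]_d.+1 * R^o -> R) (N_norm : is_norm N)
    (S : set 'rV[R]_d.+1) (S_nonempty : S !=set0) (S_closed : closed S)
    (zctr : 'rV[R]_d.+1 * R^o) (zctr_S : S zctr.1)
    (C : set 'rV[R]_d.+1) (Cn : nat -> set 'rV[R]_d.+1)
    (C_closed : closed C) (Cn_closed : forall n, closed (Cn n))
    (C_sub : forall n, C `<=` Cn n)
    (F0 : set ('rV[R]_d.+1 -> \bar R)) (F0_usc : F0 `<=` usc_fcns S)
    (F0_closed : aw_closed S N zctr F0)
    (F0_equi : forall x, S x -> equi_usc S nrm F0 x)
    (g : rVleb R d -> \bar R) (g_meas : measurable_fun (S : set (rVleb R d)) g)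
    (g_ge0 : forall x, S x -> 0 <= g x)
    (g_int : \int[@rV_lebesgue R d]_(x in S) ((nrm x)%:E * g x) < +oo)
    (F0_le : forall f x, F0 f -> S x -> `|f x| <= g x)
    (Cn_cvg : set_cvg (@rV_cvg R d) Cn C) :
  let F := [set f | F0 f /\ C (mean S f)] in
  let Fn := fun n => [set f | F0 f /\ Cn n (mean S f)] in
  set_cvg (aw_cvg S N zctr) Fn F.
Proof.
move=> F Fn.
have cst_cvg f : F f -> aw_cvg S N zctr (fun=> f) f.
  move=> [F0f _]; split; first exact: F0_usc.
  rewrite (_ : aw_dist S N zctr f f = 0); first exact: cvg_cst.
  rewrite /aw_dist integral0_eq// => rho /=; rewrite in_itv/= andbT => rho0.
  (* The supremum consists of zeros and is attained at the centre, so the distance from f to itself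
     is 0. *)
  rewrite [X in X * _](_ : _ = 0) ?mul0e//; apply/eqP; rewrite eq_le.
  apply/andP; split.
    by apply: ge_ereal_sup => _ [z _ <-]; rewrite subrr normr0.
  apply: ereal_sup_ubound; exists zctr => /=; first by rewrite subrr is_norm0.
  by rewrite subrr normr0.
have FFn f : F f -> forall n, Fn n f.
  by move=> [F0f Cf] n; split=> //; exact: C_sub.
have Outle : OutLim (aw_cvg S N zctr) Fn `<=` F.
  move=> f [phi phi_incr [a Fa af]].
  have F0a k : F0 (a k) by have [] := Fa k.
  have F0f : F0 f by exact: (F0_closed a f F0a af).
  (* The same index map [phi] shows that the mean of f lies in the outer limit of [Cn], which is
     C. *)
  split=> //; rewrite -(proj1 Cn_cvg); exists phi => //.
  exists (fun k => mean S (a k)); first by move=> k; have [] := Fa k.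
  apply: (cvg_mean nrm_norm S_closed g_meas g_ge0 g_int).
  - by move=> k; exact: F0_usc.
  - exact: F0_usc.
  - by move=> k x; exact: F0_le.
  - move=> x Sx; apply: (equi_usc_cvg N_norm nrm_norm _ _ Sx _ af.2).
    + by move=> k; exact: F0_usc.
    + exact: F0_usc.
    + exact: F0_equi.
split; apply/seteqP; split => // f.
- by move=> Ff; exists id => //; exists (fun=> f) => [k|]; [exact: FFn|exact: cst_cvg].
(* An inner limit is an outer limit: membership holds only from n0 on, so the subsequence is the
   shift by n0. *)
- move=> [a [n0 _ Fa] af]; apply: Outle; exists (addn n0) => [m n|].
    by rewrite ltn_add2l.
  exists (fun k => a (n0 + k)%N) => [k|]; first by apply: Fa => /=; exact: leq_addr.
  split; first exact: af.1.
  by have := af.2; rewrite -(cvg_shiftn n0); under eq_fun do rewrite addnC.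
- by move=> Ff; exists (fun=> f); [near=> n; exact: FFn|exact: cst_cvg].
Unshelve. all: by end_near. Qed.
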